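(* Every weakly Alster space is productively Lindelöf.
   Context: A Lindelöf space $X$ is productively Lindelöf if $X\times Z$ is Lindelöf for every Lindelöf space $Z$. A family $\mathcal G$ of $G_\delta$ subsets of a space $X$ is an Alster covering of $X$ if for every compact $K\subset X$ there is $G\in\mathcal G$ with $K\subset G$. Let $X$ be a regular space that is a subspace of its Čech–Stone compactification $\beta X$ (i.e. $X$ is Tychonoff). $X$ is weakly Alster if for every family $\mathcal G$ of $G_\delta$ subsets of $\beta X$ such that $\{G\cap X:G\in\mathcal G\}$ is an Alster covering of $X$, there is a $\sigma$-compact $Y\subset\beta X$ such that $X\subset Y\subset\bigcup\mathcal G$. *)

(* Defs.v *)
From HB Require Import structures.
From mathcomp Require Import all_boot all_order all_algebra.
From mathcomp Require Import all_classical all_reals all_analysis borel_hierarchy.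
Set Implicit Arguments.
Unset Strict Implicit.
Unset Printing Implicit Defensive.
Import Order.TTheory GRing.Theory Num.Theory numFieldNormedType.Exports.
Local Open Scope classical_set_scope.
Local Open Scope ring_scope.

Definition lindelof (T : topologicalType) : Prop :=
  forall F : set (set T), (forall U, F U -> open U) ->
    \bigcup_(U in F) U = [set: T] ->
    exists G : set (set T),
      [/\ G `<=` F, countable G & \bigcup_(U in G) U = [set: T]].

Definition productively_lindelof (X : topologicalType) : Prop :=
  lindelof X /\
  forall Z : topologicalType, lindelof Z -> lindelof (X * Z)%type.

Definition alster_covering (X : topologicalType) (F : set (set X)) : Prop :=
  (forall G, F G -> Gdelta G) /\
  (forall K : set X, compact K -> exists2 G, F G & K `<=` G).

Definition sigma_compact (T : topologicalType) (Y : set T) : Prop :=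
  exists2 K : (set T)^nat, (forall n, compact (K n)) & Y = \bigcup_n K n.

(* [completely_regular_space] separates points from closed sets by continuous
   functions to [0, 1] (see [uniform_separatorP]) but carries no T1 condition,
   hence the additional Hausdorff condition. *)
Definition tychonoff_space (X : topologicalType) : Prop :=
  hausdorff_space X /\ completely_regular_space X.

Section stone_cech.
Context (R : realType) (X : topologicalType).

Definition unit_interval : topologicalType := set_type `[0 : R, 1]%classic.

Definition cube : topologicalType :=
  prod_topology (fun _ : continuousType X unit_interval => unit_interval).

Definition cube_eval : X -> cube :=
  join_product (fun f : continuousType X unit_interval => (f : X -> _)).

(* The Cech-Stone compactification, as the closure of the canonical image of X
   in the cube [0, 1]^C(X, [0, 1]). *)
Definition stone_cech : topologicalType :=
  set_type (closure (range cube_eval)).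

Definition stone_cech_embed (x : X) : stone_cech :=
  exist _ (cube_eval x) (mem_set (@subset_closure _ _ _ (imageT cube_eval x))).

End stone_cech.

Lemma set_type_compact (T : topologicalType) (A : set T) :
  compact A -> compact [set: set_type A].
Proof.
move=> cA F PF _.
have [] := cA (set_val @ F); first by
  apply: (@filterS _ F _ setT) => [x _|]; [exact: set_valP|exact: filterT].
move=> p [Ap clp]; exists (exist _ p (mem_set Ap)); split=> // U V FU.
move=> [_ [[W oW <-]] /= Wp WV].
have [] := clp (set_val @` U) W.
- apply: (@filterS _ F _ U) FU => x Ux; by exists x.
- exact: open_nbhs_nbhs.
by move=> _ [[x Ux] <- Wx]; exists x; split => //; exact: WV.
Qed.

Lemma set_type_hausdorff (T : topologicalType) (A : set T) :
  hausdorff_space T -> hausdorff_space (set_type A).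
Proof.
move=> hT p q pq; apply: val_inj; apply: hT => U V Up Vq.
have := pq (set_val @^-1` U) (set_val @^-1` V).
case.
- exact: (@initial_continuous _ _ (@set_val T A)).
- exact: (@initial_continuous _ _ (@set_val T A)).
by move=> x [Ux Vx]; exists (set_val x).
Qed.

Section stone_cech_theory.
Context (R : realType) (X : topologicalType).

Lemma unit_interval_compact : compact [set: unit_interval R].
Proof. by apply: set_type_compact; exact: segment_compact. Qed.

Lemma cube_compact : compact [set: cube R X].
Proof.
have := @tychonoff (continuousType X (unit_interval R)) (fun=> unit_interval R)
  (fun=> setT) (fun=> unit_interval_compact).
by congr (compact _); rewrite eqEsubset; split.
Qed.

Lemma cube_hausdorff : hausdorff_space (cube R X).
Proof.
apply: hausdorff_product => _; apply: set_type_hausdorff; exact: Rhausdorff.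
Qed.

Lemma stone_cech_compact : compact [set: stone_cech R X].
Proof.
apply: set_type_compact.
apply: (subclosed_compact _ cube_compact) => //; exact: closed_closure.
Qed.

Lemma stone_cech_hausdorff : hausdorff_space (stone_cech R X).
Proof. exact: set_type_hausdorff cube_hausdorff. Qed.

Lemma stone_cech_embed_dense : closure (range (@stone_cech_embed R X)) = setT.
Proof.
rewrite eqEsubset; split => // p _ U [_ [[W oW <-]] /= Wp WU].
have := set_valP p.
case/(_ W); first exact: open_nbhs_nbhs.
move=> _ [[x _ <-] Wx]; exists (stone_cech_embed R x); split; first by exists x.
by apply: WU.
Qed.

Lemma stone_cech_extension (f : continuousType X (unit_interval R)) :
  exists g : stone_cech R X -> unit_interval R,
    continuous g /\ forall x, g (stone_cech_embed R x) = f x.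
Proof.
exists (fun p => (set_val p : cube R X) f); split => // p.
apply: (@continuous_comp _ (cube R X) _ set_val (fun c => c f)).
  exact: (@initial_continuous _ _ set_val).
exact: (@proj_continuous _ (fun=> unit_interval R) f).
Qed.

Lemma unit_interval_separate_points (tX : tychonoff_space X) :
  separate_points_from_closed
    (fun f : continuousType X (unit_interval R) => (f : X -> _)).
Proof.
move=> U x cU nUx.
have [f [cf fI f0 f1]] := (@uniform_separatorP _ R _ _).1 (tX.2 x U cU nUx).
have g0 y : f y \in `[0 : R, 1]%classic by apply/mem_set/fI; exists y.
pose g y : unit_interval R := exist _ (f y) (g0 y).
have cg : continuous g.
  move=> y V [V1 [[W oW <-]] /= Wp WU].
  apply: (@filterS _ (nbhs y) _ (f @^-1` W)).
    by move=> z Wz; apply: WU; rewrite /preimage /= set_valE.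
  by apply: cf; apply: open_nbhs_nbhs.
pose h : continuousType X (unit_interval R) := HB.pack g (isContinuous.Build _ _ g cg).
exists h; rewrite /=.
have fx : f x = 0 by apply: f0; exists x.
have nb : nbhs (g x) (set_val @^-1` [set~ (1:R)]).
  apply: (@initial_continuous _ _ set_val); apply: open_nbhs_nbhs; split.
    exact/closed_openC/accessible_closed_set1/hausdorff_accessible/Rhausdorff.
  by rewrite /= set_valE/= fx; apply/eqP; rewrite eq_sym oner_eq0.
move=> /(_ _ nb) [_ [[y Uy <-]] /=]; apply; rewrite set_valE/=; apply: f1; by exists y.
Qed.

Lemma stone_cech_embed_initial (tX : tychonoff_space X) :
  injective (@stone_cech_embed R X) /\
  (open : set (set X)) =
    (open : set (set (initial_topology (@stone_cech_embed R X)))).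
Proof.
have sep := unit_interval_separate_points tX.
have acc := hausdorff_accessible tX.1.
have inj := join_product_inj sep acc.
have cts i : continuous ((fun f : continuousType X (unit_interval R) => (f : X -> _)) i) by exact: cts_fun.
split; first by move=> x y /(congr1 set_val); rewrite !set_valE/= => /inj; apply; rewrite in_setT.
rewrite (join_product_initial sep cts inj) predeqE => U; split.
  move=> [V oV <-]; exists (set_val @^-1` V) => //; by exists V.
by move=> [_ [V oV <-] <-]; exists V.
Qed.
End stone_cech_theory.

(* X is identified with its image under [stone_cech_embed], so the trace of
   G on X is the preimage of G. *)
Definition weakly_alster (R : realType) (X : topologicalType) : Prop :=
  tychonoff_space X /\
  forall F : set (set (stone_cech R X)),
    (forall G, F G -> Gdelta G) ->
    alster_covering [set @stone_cech_embed R X @^-1` G | G in F] ->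
    exists Y : set (stone_cech R X),
      [/\ sigma_compact Y, range (@stone_cech_embed R X) `<=` Y &
          Y `<=` \bigcup_(G in F) G].

(* Main.v *)
Require Import Defs.
From mathcomp Require Import all_boot all_order all_algebra.
From mathcomp Require Import all_classical all_reals all_analysis borel_hierarchy.

(** Let [Z] be Lindelof and let an open cover of [X * Z] be given.  Since [X] is
    a subspace of its compactification, every member [W] of the cover is the
    trace of an open subset of [stone_cech R X * Z] ([rect_extension]), so the
    problem moves to [stone_cech R X * Z], where the extended members form a
    family [E] of open sets that covers [X * Z], though possibly not
    everything.

    For compact [K] inside [X], the tube lemma gives for each [z] an open
    [U] around [K] and an open [O] around [z] such that finitely many members
    of [E] cover [U `*` O].  Countably many of the sets [O] cover [Z], and the
    intersection of the corresponding sets [U] is a G-delta set containing [K]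
    whose product with [Z] is covered by countably many members of [E]
    ([compact_Gdelta_tube]).  Hence the G-delta sets [G] for which [G `*` Z] is
    countably covered by [E] trace an Alster covering on [X].

    The weak Alster property puts a sigma-compact [Y] between [X] and the union
    of these G-delta sets, so [E] covers [Y `*` Z].  This product of a
    sigma-compact set with a Lindelof space is Lindelof, by the same tube
    argument applied to each compact piece of [Y]
    ([sigma_compact_prod_lindelof]).  The resulting countable subfamily of [E]
    covers [X * Z], and so do the corresponding members of the original cover.

    That [X] itself is Lindelof follows by projecting [X * Z] onto [X] for a
    nonempty Lindelof [Z], such as [bool]. *)

Set Implicit Arguments.
Unset Strict Implicit.
Unset Printing Implicit Defensive.
Local Open Scope classical_set_scope.

(** * Countable subcovers *)

Definition countably_covered {T : Type} (F : set (set T)) (A : set T) :=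
  exists G, [/\ G `<=` F, countable G & A `<=` \bigcup_(U in G) U].

Lemma countably_covered_sub {T : Type} (F : set (set T)) (A B : set T) :
  A `<=` B -> countably_covered F B -> countably_covered F A.
Proof.
by move=> AB [G [GF cG BG]]; exists G; split => //; exact: subset_trans BG.
Qed.

Lemma countably_covered_bigcup {T I : Type} (F : set (set T)) (D : set I)
    (A : I -> set T) :
  countable D -> (forall i, D i -> countably_covered F (A i)) ->
  countably_covered F (\bigcup_(i in D) A i).
Proof.
move=> cD FA.
have /choice [G GP] : forall i, exists G : set (set T), D i ->
    [/\ G `<=` F, countable G & A i `<=` \bigcup_(U in G) U].
  move=> i; have [/FA [G GP]|nDi] := pselect (D i); first by exists G.
  by exists set0.
exists (\bigcup_(i in D) G i); split.
- by move=> U [i /GP [GF _ _]] /GF.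
- by apply: bigcup_countable => // i /GP [].
- move=> x [i Di Aix]; have [_ _ /(_ x Aix) [U GU Ux]] := GP i Di.
  by exists U => //; exists i.
Qed.

(** Transfers a countable subcover found after enlarging the members of [F]:
    [e W] is an extension of [W] along [f], and each extension that is used is
    traded for one [W] that it extends. *)
Lemma countably_covered_preimage {S T : Type} (f : S -> T)
    (e : set S -> set T) (F : set (set S)) (A : set S) :
  (forall W, F W -> f @^-1` e W `<=` W) ->
  countably_covered (e @` F) (f @` A) -> countably_covered F A.
Proof.
move=> eW [G [GF cG AG]].
have -> : A = \bigcup_(V in G) (A `&` f @^-1` V).
  rewrite -setI_bigcupr -preimage_bigcup; apply/esym/setIidPl => x Ax.
  by apply: AG; exists x.
apply: countably_covered_bigcup => // V /GF [W FW <-].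
exists [set W]; split; first by move=> _ ->.
- exact: countable1.
- by rewrite bigcup_set1 => x [_ /eW]; apply.
Qed.

Lemma countable_bigcap_open_Gdelta (T : topologicalType) (I : Type)
    (D : set I) (U : I -> set T) :
  countable D -> (forall i, D i -> open (U i)) ->
  Gdelta (\bigcap_(i in D) U i).
Proof.
move=> /pfcard_geP [->|[f]] oU.
  by rewrite bigcap_set0; apply: open_Gdelta; exact: openT.
exists (U \o f) => [n|]; first by apply: oU; exact: funS.
by rewrite -[in LHS](image_eq f) bigcap_image.
Qed.

(** * Tubes around compact sets *)

(** Compactness as an induction principle: an ideal of sets that contains a
    neighbourhood of each point of [K] contains [K].  Otherwise the sets whose
    complement in [K] lies in the ideal form a proper filter on [K], and a
    cluster point in [K] of that filter has no neighbourhood in the ideal.  In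
    this form the tube lemma needs neither choice of neighbourhoods nor
    bookkeeping of finite subcovers, and [T] may be empty. *)
Lemma compact_ideal (T : topologicalType) (K : set T) (P : set (set T)) :
  compact K -> P set0 -> (forall A B, A `<=` B -> P B -> P A) ->
  (forall A B, P A -> P B -> P (A `|` B)) ->
  (forall x, K x -> exists2 U, nbhs x U & P U) -> P K.
Proof.
move=> cK P0 Psub PU Pnbhs; apply: contrapT => nPK.
have PF : ProperFilter [set A | P (K `\` A)].
  split => [/=|]; first by rewrite setD0.
  split => [|A B PA PB|A B AB PA] /=; first by rewrite setDT.
  - by rewrite setDIr; exact: PU.
  - by apply: Psub PA; exact: setDS.
have [|x [Kx xcl]] := cK _ PF; first by rewrite /= setDv.
have [U xU PxU] := Pnbhs x Kx.
have [|y [nUy Uy]] := xcl (~` U) U _ xU; last exact: nUy.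
by apply: Psub PxU => y [_ /contrapT].
Qed.

(** The tube lemma.  The sets [A] that have an open superset [U] and an open
    [O] around [z] with [U `*` O] countably covered form an ideal, because two
    such [O] may be intersected while the sets [U] are united; a point of [K]
    lies in the interior of a rectangle inside a single member of [F]. *)
Lemma compact_slice_tube (T Z : topologicalType) (K : set T)
    (F : set (set (T * Z))) (z : Z) :
  compact K -> (forall W, F W -> open W) ->
  K `*` [set z] `<=` \bigcup_(W in F) W ->
  exists U O, [/\ open U, K `<=` U, open O, O z & countably_covered F (U `*` O)].
Proof.
move=> cK oF Kz.
pose P A := exists U O,
  [/\ open U, A `<=` U, open O, O z & countably_covered F (U `*` O)].
rewrite -/(P K); apply: compact_ideal => //.
- exists set0, setT; split; [exact: open0|done|exact: openT|done|].
  by rewrite set0X; exists set0; split.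
- move=> A B AB [U [ O [oU BU oO Oz UO]]]; exists U, O.
  by split => //; exact: subset_trans BU.
- move=> A B [U [ O [oU AU oO Oz UO]]] [V [Q [oV BV oQ Qz VQ]]].
  exists (U `|` V), (O `&` Q); split => //.
  + exact: openU.
  + exact: setUSS.
  + exact: openI.
  + apply: (@countably_covered_sub _ _ _ ((U `*` O) `|` (V `*` Q))).
      by move=> p [[Up|Vp] [Op Qp]]; [left|right].
    rewrite -bigcup2E; apply: countably_covered_bigcup => // -[|[|n]] _ //=.
    by exists set0; split.
- move=> x Kx; have [W FW Wxz] := Kz (x, z) (conj Kx erefl).
  have := oF W FW; rewrite openE => /(_ _ Wxz) [[A B] /= [Ax Bz] ABW].
  exists A° => //; first exact: nbhs_interior.
  exists A°, B°; split => //; [exact: open_interior|exact: open_interior|].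
  exists [set W]; split; [by move=> _ ->|exact: countable1|].
  rewrite bigcup_set1 => p [/interior_subset Ap /interior_subset Bp].
  exact: ABW.
Qed.

(** The Lindelof property of [Z] reduces the tubes around [K] to countably many;
    intersecting their sides leaves only a G-delta set around [K], which is the
    reason why Alster coverings consist of G-delta sets. *)
Lemma compact_Gdelta_tube (T Z : topologicalType) (K : set T)
    (F : set (set (T * Z))) :
  compact K -> lindelof Z -> (forall W, F W -> open W) ->
  K `*` setT `<=` \bigcup_(W in F) W ->
  exists D, [/\ Gdelta D, K `<=` D & countably_covered F (D `*` setT)].
Proof.
move=> cK lZ oF KF.
pose good (O : set Z) (U : set T) :=
  [/\ open U, K `<=` U & countably_covered F (U `*` O)].
have [|//|N [NO cN NT]] := lZ [set O | open O /\ exists U, good O U].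
- by move=> O [].
- apply/seteqP; split => // z _.
  have [|U [ O [oU KU oO Oz UO]]] := compact_slice_tube (z := z) cK oF.
    by move=> p [Kp _]; apply: KF.
  by exists O => //; split => //; exists U.
have /choice [U UP] : forall O, exists U, N O -> good O U.
  move=> O; have [/NO [_ [U gU]]|nNO] := pselect (N O); first by exists U.
  by exists set0.
exists (\bigcap_(O in N) U O); split.
- by apply: countable_bigcap_open_Gdelta => // O /UP [].
- by move=> x Kx O /UP [_ KU _]; exact: KU.
- apply: (@countably_covered_sub _ _ _ (\bigcup_(O in N) (U O `*` O))).
    move=> [x z] [/= Ux _]; have [ O ON Oz] : (\bigcup_(O in N) O) z.
      by rewrite NT.
    by exists O => //; split => //; exact: Ux.
  by apply: countably_covered_bigcup => // O /UP [].
Qed.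

Lemma sigma_compact_prod_lindelof (T Z : topologicalType) (Y : set T)
    (F : set (set (T * Z))) :
  sigma_compact Y -> lindelof Z -> (forall W, F W -> open W) ->
  Y `*` setT `<=` \bigcup_(W in F) W -> countably_covered F (Y `*` setT).
Proof.
move=> [K cK ->] lZ oF KF; rewrite setX_bigcupl.
apply: countably_covered_bigcup => // n _.
have [|D [_ KD]] := compact_Gdelta_tube (cK n) lZ oF.
  by move=> [x z] [/= Kx _]; apply: KF; split => //; exists n.
by apply: countably_covered_sub; exact: setSX.
Qed.

(** * Extending open sets along an embedding *)

(** The largest open subset of [T * Z] whose trace on [X * Z] is inside [W],
    written as a union of open rectangles so that openness and the trace can be
    read off. *)
Definition rect_extension (X T Z : topologicalType) (e : X -> T)
    (W : set (X * Z)) : set (T * Z) :=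
  \bigcup_(R in [set R : set T * set Z |
    [/\ open R.1, open R.2 & (e @^-1` R.1) `*` R.2 `<=` W]]) (R.1 `*` R.2).

Section rect_extension.
Context (X T Z : topologicalType) (e : X -> T).
Implicit Type W : set (X * Z).

Lemma open_rect_extension W : open (rect_extension e W).
Proof.
apply: bigcup_open => -[A B] [/= oA oB _].
rewrite openE => -[a b] [/= Aa Bb].
by exists (A, B) => //; split; apply: open_nbhs_nbhs.
Qed.

Lemma rect_extension_trace W :
  (fun p : X * Z => (e p.1, p.2)) @^-1` rect_extension e W `<=` W.
Proof. by move=> [x z] [[A B] /= [_ _ ABW] [Ax Bz]]; exact: ABW. Qed.

(** For [e] inducing the topology of [X], no point of an open [W] is lost. *)
Lemma rect_extension_sub W x z :
  (forall U : set X, open U -> exists2 V : set T, open V & e @^-1` V = U) ->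
  open W -> W (x, z) -> rect_extension e W (e x, z).
Proof.
move=> ie; rewrite openE => oW /oW [[A B] /= [Ax Bz] ABW].
have [V oV eV] := ie _ (open_interior A).
exists (V, B°) => /=.
- split => //; first exact: open_interior.
  rewrite eV => p [/interior_subset Ap /interior_subset Bp]; exact: ABW.
- by split => //; rewrite -[V _]/((e @^-1` V) x) eV.
Qed.

End rect_extension.

(** * Products with weakly Alster spaces *)

Lemma lindelof_bool : lindelof bool.
Proof.
move=> F oF FT; have FE b : exists2 U, F U & U b.
  by have : [set: bool] b by []; rewrite -FT => -[U FU Ub]; exists U.
have [[U FU Ut] [V FV Vf]] := (FE true, FE false).
exists [set U; V]; split; first by move=> _ [] ->.
- exact/finite_set_countable.
- by apply/seteqP; split => // -[] _; [exists U => //; left|exists V => //; right].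
Qed.

(** An open cover of [X] lifts to a cover of [X * Z] by cylinders, and a
    countable subcover of those is read back on one slice. *)
Lemma lindelof_prod_fst (X Z : topologicalType) :
  [set: Z] !=set0 -> lindelof (X * Z)%type -> lindelof X.
Proof.
move=> [z _] lXZ F oF FT.
have [||G [GF cG GT]] := lXZ ((fun U => fst @^-1` U) @` F).
- by move=> _ [U /oF oU <-]; apply: open_comp => // p _; exact: cvg_fst.
- apply/seteqP; split => // -[x y] _.
  have : [set: X] x by []; rewrite -FT => -[U FU Ux].
  by exists (fst @^-1` U) => //; exists U.
have [||H [HF cH HT]] := @countably_covered_preimage X (X * Z)%type
  (fun x => (x, z)) (fun U => fst @^-1` U) F setT.
- by move=> U _ x.
- by exists G; split => //; rewrite GT.
by exists H; split => //; apply/seteqP; split.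
Qed.

Lemma weakly_alster_prod (R : realType) (X Z : topologicalType) :
  weakly_alster R X -> lindelof Z -> lindelof (X * Z)%type.
Proof.
move=> [tX wX] lZ F oF FT.
pose e := @stone_cech_embed R X.
have [_ iX] := stone_cech_embed_initial R tX.
have eV (U : set X) : open U ->
    exists2 V : set (stone_cech R X), open V & e @^-1` V = U.
  by rewrite iX.
have ce : continuous e by apply/continuousP => V oV; rewrite iX; exists V.
pose E := rect_extension e @` F.
have oE V : E V -> open V by move=> [W _ <-]; exact: open_rect_extension.
have EX x z : (\bigcup_(V in E) V) (e x, z).
  have : [set: X * Z] (x, z) by []; rewrite -FT => -[W FW Wxz].
  exists (rect_extension e W); first by exists W.
  exact: rect_extension_sub (oF _ FW) Wxz.
have [||Y [sY XY YF]] := wX [set G | Gdelta G /\ countably_covered E (G `*` setT)].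
- by move=> G [].
- split.
    move=> _ [G [[U oU ->] _] <-]; exists (fun n => e @^-1` U n).
      by move=> n; apply: open_comp => // x _; exact: ce.
    by rewrite preimage_bigcap.
  move=> K cK.
  have ceK : compact (e @` K).
    by apply: continuous_compact => //; exact: continuous_subspaceT.
  have [|G [dG KG cG]] := compact_Gdelta_tube ceK lZ oE.
    by move=> [_ z] [/= [x _ <-] _]; exact: EX.
  by exists (e @^-1` G); [exists G|move=> x Kx; apply: KG; exists x].
have YE : countably_covered E (Y `*` setT).
  apply: sigma_compact_prod_lindelof => // -[y z] [/= /YF [G [_ [H [HE _ GH]]]] Gy _].
  by have [|V /HE EV Vyz] := GH (y, z); [|exists V].
have [||G [GF cG GT]] := @countably_covered_preimage (X * Z)%type _
    (fun p => (e p.1, p.2)) (rect_extension e) F setT.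
- by move=> W _; exact: rect_extension_trace.
- apply: countably_covered_sub YE => _ [[x z] _ <-].
  by split => //; apply: XY; exists x.
by exists G; split => //; apply/seteqP; split.
Qed.

Theorem proposition4p4 (R : realType) (X : topologicalType) :
  weakly_alster R X -> productively_lindelof X.
Proof.
move=> wX; split; last by move=> Z; exact: weakly_alster_prod wX.
apply: (@lindelof_prod_fst _ bool); first by exists true.
exact: weakly_alster_prod wX lindelof_bool.
Qed.
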